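(* Let $(\varphi,\psi)$ be a pair of kernels and let $S_w^{\varphi,\psi}$, $w>0$, be the associated Durrmeyer sampling operators. Let $f\in L^\infty(\mathbb{R})$. Then $$\lim_{w\to+\infty}(S_w^{\varphi,\psi}f)(x)=f(x)$$ at every point $x\in\mathbb{R}$ of continuity of $f$. Moreover, if $f\in C(\mathbb{R})$, then $$\lim_{w\to+\infty}\lVert S_w^{\varphi,\psi}f-f\rVert_\infty=0.$$
   Context: $C(\mathbb{R})$ denotes the space of all uniformly continuous and bounded functions $f:\mathbb{R}\to\mathbb{R}$, and $\lVert\cdot\rVert_\infty$ is the sup norm. A pair of kernels $(\varphi,\psi)$ is a pair of functions $\varphi,\psi:\mathbb{R}\to\mathbb{R}$ in $L^1(\mathbb{R})$ such that: $\varphi$ is bounded in a neighborhood of the origin; $\sum_{k\in\mathbb{Z}}\varphi(u-k)=1$ for every $u\in\mathbb{R}$; $\int_{\mathbb{R}}\psi(u)\,du=1$; and there exists $r>0$ with $M_r(\varphi)<+\infty$, where for $\nu\ge 0$ $$M_\nu(\varphi):=\sup_{u\in\mathbb{R}}\sum_{k\in\mathbb{Z}}|\varphi(u-k)|\,|u-k|^\nu .$$ The Durrmeyer sampling operators based on $\varphi,\psi$ are defined, for $w>0$ and any $f$ for which the series converges for every $x$, by $$(S_w^{\varphi,\psi}f)(x)=\sum_{k\in\mathbb{Z}}\varphi(wx-k)\,w\int_{\mathbb{R}}\psi(wu-k)f(u)\,du,\qquad x\in\mathbb{R}.$$ *)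

(* Defs.v *)
From HB Require Import structures.
From mathcomp Require Import all_boot all_order all_algebra.
From mathcomp Require Import all_classical all_reals all_analysis.
Import Order.TTheory GRing.Theory Num.Theory.
Import numFieldNormedType.Exports.

Set Implicit Arguments.
Unset Strict Implicit.
Unset Printing Implicit Defensive.

Local Open Scope classical_set_scope.
Local Open Scope ring_scope.

(* The real line with the sigma-algebra of Lebesgue-measurable (not only Borel)
   sets; it is convertible to [R]. *)
Notation lebesgueType R :=
  (caratheodory_type ((@wlength R idfun)^*)%mu).

Section lebesgue_spaces.
Context {R : realType}.

Definition leb : {measure set (lebesgueType R) -> \bar R} :=
  @completed_lebesgue_measure R.

(* Elements of L^p are functions, not classes: their values at points matter. *)
Definition Lp (p : \bar R) (f : R -> R) : Prop :=
  (f : lebesgueType R -> R) \in Lfun leb p.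

Definition integralR (f : R -> R) : R :=
  (\int[leb]_(u in [set: lebesgueType R]) f u)%R.

Definition integrableR (f : R -> R) : Prop :=
  leb.-integrable [set: lebesgueType R] (EFin \o f).

End lebesgue_spaces.

Section Durrmeyer.
Context {R : realType}.
Implicit Types (phi psi f : R -> R) (a : int -> R).

(* A series over the integers converges when its two halves do
   ([Negz n] is [- n.+1]). *)
Definition cvg_zseries a : Prop :=
  cvgn (series (fun n => a (Posz n))) /\ cvgn (series (fun n => a (Negz n))).

Definition zsum a : R :=
  limn (series (fun n => a (Posz n))) + limn (series (fun n => a (Negz n))).

Definition abs_moment (nu : R) phi : \bar R :=
  ereal_sup [set \esum_(k in [set: int])
    (`|phi (u - k%:~R)| * `|u - k%:~R| `^ nu)%:E | u in [set: R]].

Record kernel_pair phi psi : Prop := KernelPair {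
  kernel_phi_L1 : Lp 1%E phi ;
  kernel_psi_L1 : Lp 1%E psi ;
  kernel_phi_bounded : bounded_near phi (nbhs (0 : R)) ;
  kernel_phi_cvg : forall u : R, cvg_zseries (fun k => phi (u - k%:~R)) ;
  kernel_phi_sum : forall u : R, zsum (fun k => phi (u - k%:~R)) = 1 ;
  kernel_psi_int : integralR psi = 1 ;
  kernel_moment : exists2 r : R, 0 < r & (abs_moment r phi < +oo)%E
}.

Definition durrmeyer_term phi psi (w : R) f (x : R) (k : int) : R :=
  phi (w * x - k%:~R) * (w * integralR (fun u => psi (w * u - k%:~R) * f u)).

Definition durrmeyer phi psi (w : R) f (x : R) : R :=
  zsum (durrmeyer_term phi psi w f x).

(* [integralR] and [zsum] are total, so that the integrals and the series
   defining [durrmeyer] make sense has to be said separately. *)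
Definition durrmeyer_defined phi psi (w : R) f : Prop :=
  (forall k : int, integrableR (fun u => psi (w * u - k%:~R) * f u)) /\
  (forall x : R, cvg_zseries (durrmeyer_term phi psi w f x)).

Definition unif_cont_bounded f : Prop :=
  unif_continuous f /\ [bounded f x | x in [set: R]].

Definition supnorm f : \bar R :=
  ereal_sup [set (`|f x|)%:E | x in [set: R]].

End Durrmeyer.

(* Main.v *)
Require Import Defs.
From mathcomp Require Import all_boot all_order all_algebra.
From mathcomp Require Import all_classical all_reals all_analysis.
From mathcomp Require Import measurable_realfun ess_sup_inf.
From mathcomp Require Import ring lra.
Import Order.TTheory GRing.Theory Num.Theory.
Import numFieldNormedType.Exports.

Set Implicit Arguments.
Unset Strict Implicit.
Unset Printing Implicit Defensive.

Local Open Scope classical_set_scope.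
Local Open Scope ring_scope.

(** Write t_k for the k-th coefficient of the operator, so that
    S_w f x = \sum_k phi(wx - k) t_k.  Since the translates of phi sum to 1,
    S_w f x - c = \sum_k phi(wx - k) (t_k - c) for every constant c, and since
    psi has integral 1, t_k - c = w * \int psi(wu - k) (f u - c) du.

    Suppose |f - c| <= K almost everywhere and |f u - c| <= e when
    |u - x| < gam, and put rho := gam w / 2.  A point u at distance >= gam
    from x satisfies |wu - k| >= rho or |wx - k| >= rho.  In the first case u
    lies where psi(wu - k) has a small tail; in the second one
    1 <= |wx - k|^r rho^-r.  With P the L^1 norm of psi and tail rho the
    integral of |psi| over |t| >= rho, both cases are covered by one bound,
    valid for all k ([coefficient_dist]):
      |t_k - c| <= P (e + K |wx - k|^r rho^-r) + K tail rho.
    Summing it against |phi(wx - k)| brings in only the moments M_0 and M_r of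
    phi ([durrmeyer_term_abs_zsum]):
      |S_w f x - c| <= M_0 (P e + K tail rho) + M_r P K rho^-r.
    M_0 is finite because phi is bounded near the origin and is dominated by
    its r-th moment elsewhere ([kernel_abs_zsum]).

    The right-hand side does not involve x, and as w grows all of it but M_0 P e
    tends to 0 ([durrmeyer_cvg_unif]).  Taking c = f x gives the convergence
    at a point of continuity, where gam may depend on x, and the uniform
    convergence when gam can be chosen independently of x.  Taking c = 0 and
    for e = K an essential bound of f gives the convergence of the series.

    The bound on t_k - c is the integral of a function of wu - k, reduced to P
    and tail rho by an affine change of variables; for the full Lebesgue
    sigma-algebra this change of variables comes from the scaling of the outer
    measure ([outer_preimage_affine]). *)

(** * Lebesgue measure and integral under affine maps *)

Section affine.
Context {R : realType}.
Implicit Types (w c : R) (A : set R).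

Local Notation outer := ((@wlength R idfun)^*)%mu.

Definition affine w c (u : R) : R := w * u - c.

Lemma preimage_affine_itv w c (a b : R) : 0 < w ->
  affine w c @^-1` `]a, b]%classic =
  `]w^-1 * (a + c), w^-1 * (b + c)]%classic.
Proof.
move=> w0; apply/seteqP; split => u /=; rewrite !in_itv/= /affine.
  by rewrite ltrBrDr lerBlDr ltr_pdivrMl// ler_pdivlMl.
by rewrite ltrBrDr lerBlDr ltr_pdivrMl// ler_pdivlMl.
Qed.

Lemma wlength_preimage_affine w c A : 0 < w -> ocitv A ->
  wlength idfun (affine w c @^-1` A) = ((w^-1)%:E * wlength idfun A)%E.
Proof.
move=> w0 [[a b] _ <-] /=; rewrite preimage_affine_itv//.
rewrite !wlength_itv/= !lte_fin.
rewrite ltr_pM2l ?invr_gt0// ltrD2r; case: ifPn => _; last by rewrite mule0.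
by rewrite -!EFinB -EFinM; congr EFin; ring.
Qed.

(** An affine map turns a cover by half-open intervals into a cover of the
    preimage, with all lengths scaled by the same factor.  The reverse
    inequality is this one for the inverse map, affine too. *)
Let outer_preimage_affine_le w c A : 0 < w ->
  (outer (affine w c @^-1` A) <= (w^-1)%:E * outer A)%E.
Proof.
move=> w0; rewrite -lee_pdivrMl ?invr_gt0// invrK.
apply: le_ereal_inf_tmp => _ [F [mF AF] <-].
rewrite -lee_pdivlMl// -nneseriesZl; last by move=> *; exact: wlength_ge0.
apply: ereal_inf_lbound; exists (fun n => affine w c @^-1` F n).
  split=> [n|u /= /AF[n _ Fn]]; last by exists n.
  have [[a b] _ Fab] := mF n.
  by rewrite -Fab /= preimage_affine_itv//; exact: is_ocitv.
by apply: eq_eseriesr => n _; rewrite wlength_preimage_affine//; exact: mF.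
Qed.

Lemma outer_preimage_affine w c A : 0 < w ->
  outer (affine w c @^-1` A) = ((w^-1)%:E * outer A)%E.
Proof.
move=> w0; apply/eqP; rewrite eq_le outer_preimage_affine_le//=.
rewrite lee_pdivrMl//.
have {1}-> : A = affine w^-1 (- (w^-1 * c)) @^-1` (affine w c @^-1` A).
  rewrite -comp_preimage [X in X @^-1` _](_ : _ = id)//.
  by apply/funext => u; rewrite /affine /=; field; rewrite gt_eqF.
apply: le_trans (outer_preimage_affine_le _ _ _) _; rewrite ?invr_gt0//.
by rewrite invrK.
Qed.


(** The Caratheodory criterion is stated with the outer measure alone, so it
    is transported by a bijection that scales the outer measure; this covers
    the non-Borel measurable sets at once. *)
Lemma caratheodory_preimage_affine w c A : 0 < w ->
  caratheodory_measurable outer A ->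
  caratheodory_measurable outer (affine w c @^-1` A).
Proof.
move=> w0 mA X.
have [Y ->] : exists Y, X = affine w c @^-1` Y.
  exists (affine w^-1 (- (w^-1 * c)) @^-1` X).
  rewrite -comp_preimage [X in X @^-1` _](_ : _ = id)//.
  by apply/funext => u; rewrite /affine /=; field; rewrite gt_eqF.
rewrite preimage_setC -(preimage_setI (affine w c) Y A).
rewrite -(preimage_setI (affine w c) Y (~` A)) !outer_preimage_affine//.
rewrite -ge0_muleDr; [|exact: outer_measure_ge0..].
by congr (_ * _)%E; exact: mA.
Qed.

Lemma measurable_affine w c : 0 < w ->
  measurable_fun [set: lebesgueType R]
    (affine w c : lebesgueType R -> lebesgueType R).
Proof.
by move=> w0 _ /= A mA; rewrite setTI; exact: caratheodory_preimage_affine.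
Qed.

(** The image of the measure by the affine map is the measure multiplied by
    the inverse of the slope. *)
Lemma ge0_integral_affine w c (g : lebesgueType R -> \bar R) : 0 < w ->
  measurable_fun [set: lebesgueType R] g -> (forall u, 0 <= g u)%E ->
  (\int[leb]_u g (w * u - c)%R = (w^-1)%:E * \int[leb]_u g u)%E.
Proof.
move=> w0 mg g0.
have wV0 : 0 <= w^-1 by rewrite invr_ge0 ltW.
pose a : lebesgueType R -> lebesgueType R := affine w c.
have ma : measurable_fun setT a := measurable_affine c w0.
rewrite -(ge0_integral_mscale leb measurableT (NngNum wV0) mg)//.
have := @ge0_integral_pushforward _ _ _ _ _ a ma leb setT g measurableT mg
  (fun y _ => g0 y).
rewrite preimage_setT => <-.
apply: eq_measure_integral => A _ _; rewrite /pushforward /mscale/=.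
exact: outer_preimage_affine.
Qed.

Lemma integrableR_affine w c (g : R -> R) : 0 < w -> integrableR g ->
  integrableR (fun u => g (w * u - c)).
Proof.
move=> w0 /integrableP[mg ig]; apply/integrableP; split.
  exact: (measurableT_comp mg (measurable_affine c w0)).
have mag : measurable_fun [set: lebesgueType R] (abse \o (EFin \o g)).
  exact: measurableT_comp.
have := @ge0_integral_affine w c (abse \o (EFin \o g)) w0 mag
  (fun=> abse_ge0 _).
rewrite /comp => ->.
by rewrite lte_mul_pinfty// lee_fin invr_ge0 ltW.
Qed.

Lemma integralR_affine w c (g : R -> R) : 0 < w -> integrableR g ->
  integralR (fun u => g (w * u - c)) = w^-1 * integralR g.
Proof.
move=> w0 ig; have /integrableP[mg _] := ig.
rewrite /integralR /Rintegral.
rewrite [in LHS]integralE [in RHS]integralE.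
have mgp := measurable_funepos mg.
have mgn := measurable_funeneg mg.
have := @ge0_integral_affine w c _ w0 mgp (funepos_ge0 _).
have := @ge0_integral_affine w c _ w0 mgn (funeneg_ge0 _).
pose a : lebesgueType R -> lebesgueType R := fun u => w * u - c.
have := @funepos_comp _ _ _ (EFin \o g) a.
have := @funeneg_comp _ _ _ (EFin \o g) a.
rewrite /comp /a => -> ->.
move=> /= -> ->.
have fp := integrable_fin_num measurableT (integrable_funepos measurableT ig).
have fn := integrable_fin_num measurableT (integrable_funeneg measurableT ig).
rewrite -muleBr//; last by rewrite fin_num_adde_defr.
rewrite fineM// fin_numB fp.
exact: fn.
Qed.
End affine.

(** * Absolutely convergent series over the integers *)

Section zseries.
Context {R : realType}.
Implicit Types a b : int -> R.

(** A bound on finite partial sums, so that comparison and linear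
    combination reduce to finite sums; it is what finiteness of an unordered
    sum of absolute values amounts to. *)
Definition abs_zsum_le a (B : R) : Prop := forall n : nat,
  \sum_(0 <= i < n) `|a (Posz i)| + \sum_(0 <= i < n) `|a (Negz i)| <= B.

Lemma esum_abs_zsum_le a B :
  (\esum_(k in [set: int]) (`|a k|)%:E <= B%:E)%E -> abs_zsum_le a B.
Proof.
move=> aB n; rewrite -lee_fin; apply: le_trans aB.
have a0 k : [set: int] k -> (0 <= (`|a k|)%:E)%E by rewrite lee_fin.
rewrite (esumID (range Posz) _ _ a0) !setTI.
have -> : ~` range Posz = range Negz.
  apply/seteqP; split => [[k|k]|_ [k _ <-]].
  - by move=> /(_ (ex_intro2 _ _ k I erefl)).
  - by exists k.
  - by case.
rewrite !esum_image; [|by move=> i j _ _ []..].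
rewrite -!nneseries_esumT//.
by rewrite EFinD -!sumEFin; apply: leeD; apply: nneseries_lim_ge.
Qed.

Lemma abs_zsum_le_cvg a B : abs_zsum_le a B -> cvg_zseries a.
Proof.
move=> aB; split; apply: normed_cvg; apply: nondecreasing_is_cvgn.
- apply: (@nondecreasing_series _ (fun i => `|_ i|) predT 0) => *.
  exact: normr_ge0.
- exists B => _ [n _ <-]; apply: le_trans (aB n).
  by rewrite /series/= lerDl sumr_ge0.
- apply: (@nondecreasing_series _ (fun i => `|_ i|) predT 0) => *.
  exact: normr_ge0.
- exists B => _ [n _ <-]; apply: le_trans (aB n).
  by rewrite /series/= lerDr sumr_ge0.
Qed.

Lemma abs_zsum_le_norm a B : abs_zsum_le a B -> `|zsum a| <= B.
Proof.
move=> aB; have [cP cN] := abs_zsum_le_cvg aB.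
rewrite /zsum -limD// -lim_norm; last exact: is_cvgD.
apply: limr_le; first by apply: is_cvg_norm; exact: is_cvgD.
apply: nearW => n; apply: le_trans (aB n).
by apply: le_trans (ler_normD _ _) _; apply: lerD; exact: ler_norm_sum.
Qed.

Lemma zsumBr a b c : cvg_zseries a -> cvg_zseries b ->
  zsum a - zsum b * c = zsum (fun k => a k - b k * c).
Proof.
move=> [aP aN] [bP bN]; rewrite /zsum mulrDl opprD addrACA.
have h (s t : nat -> R) : cvgn (series s) -> cvgn (series t) ->
    limn (series s) - limn (series t) * c =
    limn (series (fun n => s n - t n * c)).
  move=> cs ct; apply/esym/cvg_lim => //.
  rewrite (_ : series _ = (fun n => series s n - series t n * c)).
    by apply: cvgB => //; apply: cvgMl.
  by apply/funext => n; rewrite /series/= sumrB mulr_suml.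
by rewrite !h.
Qed.

Lemma abs_zsum_le_dominated a b1 b2 (c1 c2 B1 B2 : R) : 0 <= c1 -> 0 <= c2 ->
  (forall k, `|a k| <= `|b1 k| * c1 + `|b2 k| * c2) ->
  abs_zsum_le b1 B1 -> abs_zsum_le b2 B2 ->
  abs_zsum_le a (B1 * c1 + B2 * c2).
Proof.
move=> c10 c20 ab bB1 bB2 n.
apply: (@le_trans _ _ (
  (\sum_(0 <= i < n) `|b1 (Posz i)| + \sum_(0 <= i < n) `|b1 (Negz i)|) * c1 +
  (\sum_(0 <= i < n) `|b2 (Posz i)| + \sum_(0 <= i < n) `|b2 (Negz i)|) * c2)).
  rewrite !mulrDl addrACA !mulr_suml -!big_split/=.
  by apply: ler_sum => i _; apply: lerD; exact: ab.
by apply: lerD; apply: ler_wpM2r.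
Qed.

End zseries.

(** * Coefficients of the operator *)

Lemma leb_ae_filter (R : realType) : Filter (nbhs (almost_everywhere (@leb R))).
Proof. exact: ae_filter_ringOfSetsType. Qed.
#[local] Existing Instance leb_ae_filter.

Section coef.
Context {R : realType}.
Implicit Types (psi f g h : R -> R) (w c rho : R).

(** Borel sets are Lebesgue measurable. *)
Lemma measurable_id_lebesgueType :
  measurable_fun [set: lebesgueType R] (id : lebesgueType R -> R).
Proof.
move=> _ A mA; rewrite setTI preimage_id; exact: sub_caratheodory.
Qed.

Lemma integrableR_measurable g : integrableR g ->
  measurable_fun [set: lebesgueType R] (g : lebesgueType R -> R).
Proof. by move=> /integrableP[/measurable_EFinP]. Qed.

Lemma integrableR_norm g : integrableR g -> integrableR (fun u => `|g u|).
Proof. by move=> ig; exact: (integrable_norm ig). Qed.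

Lemma integrableR_dominated g h :
    measurable_fun [set: lebesgueType R] (g : lebesgueType R -> R) ->
    integrableR h -> (forall u, 0 <= h u) ->
    (\forall u \ae (@leb R), `|g u| <= h u) ->
  integrableR g /\ `|integralR g| <= integralR h.
Proof.
move=> mg ih h0 gh.
have /integrableP[mh hoo] := ih.
have le_gh : (\int[leb]_u (`|g u|)%:E <= \int[leb]_u (h u)%:E)%E.
  apply: (@ae_ge0_le_integral _ (lebesgueType R) R leb setT measurableT).
  - by move=> u _; rewrite lee_fin.
  - apply/measurable_EFinP.
    exact: (measurableT_comp (@normr_measurable R setT) mg).
  - by move=> u _; rewrite lee_fin.
  - exact: mh.
  - by apply: filterS gh => u ghu _; rewrite lee_fin.
have ig : integrableR g.
  apply/integrableP; split; first exact/measurable_EFinP.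
  apply: le_lt_trans hoo; apply: le_trans le_gh _.
  apply: (@ge0_le_integral _ (lebesgueType R) R leb setT measurableT).
  - by move=> u _; rewrite lee_fin.
  - exact: mh.
  - exact: (measurableT_comp (@abse_measurable R setT) mh).
  - by move=> u _; exact: ler_norm.
split => //; apply: le_trans (le_normr_Rintegral measurableT ig) _.
apply: fine_le => //.
- exact: integrable_fin_num (integrableR_norm ig).
- exact: integrable_fin_num ih.
Qed.

Definition tail_fun rho psi (t : R) : R := if rho <= `|t| then `|psi t| else 0.

Definition tail rho psi : R := integralR (tail_fun rho psi).

Lemma tail_fun_ge0 rho psi t : 0 <= tail_fun rho psi t.
Proof. by rewrite /tail_fun; case: ifP. Qed.

(** Stated over an arbitrary measurable type, as nothing depends on the
    completion of the sigma-algebra. *)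
Lemma measurable_cut_norm d (T : measurableType d) (p g : T -> R) rho :
  measurable_fun setT p -> measurable_fun setT g ->
  measurable_fun setT (fun t => if rho <= `|p t| then `|g t| else 0).
Proof.
move=> mp mg; apply: measurable_fun_ifT => //; last exact: measurableT_comp.
by apply: measurable_fun_ler => //; exact: measurableT_comp.
Qed.

Lemma measurable_tail_fun rho psi : integrableR psi ->
  measurable_fun [set: lebesgueType R]
    (tail_fun rho psi : lebesgueType R -> R).
Proof.
move=> /integrableR_measurable mpsi.
exact: (measurable_cut_norm rho measurable_id_lebesgueType mpsi).
Qed.

Lemma integrable_tail_fun rho psi : integrableR psi ->
  integrableR (tail_fun rho psi).
Proof.
move=> ipsi.
have [||||//] := @integrableR_dominated (tail_fun rho psi) (fun u => `|psi u|).
- exact: measurable_tail_fun.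
- exact: integrableR_norm.
- by move=> u; exact: normr_ge0.
- by apply: nearW => u; rewrite /tail_fun; case: ifP; rewrite ?normr_id ?normr0.
Qed.

Lemma tail_nonincreasing psi rho rho' : integrableR psi -> rho <= rho' ->
  tail rho' psi <= tail rho psi.
Proof.
move=> ipsi rr; apply: le_Rintegral => //; [exact: integrable_tail_fun..|].
move=> t _; rewrite /tail_fun; case: (leP rho' `|t|) => [/(le_trans rr) ->//|_].
exact: tail_fun_ge0.
Qed.

(** Dominated convergence along the integers; monotonicity of the tail in its
    radius extends the limit to real radii. *)
Lemma tail_cvg0 psi : integrableR psi -> tail rho psi @[rho --> +oo] --> 0.
Proof.
move=> ipsi.
have tail0 : tail n%:R psi @[n --> \oo] --> 0.
  have [|||||_ _] := @dominated_convergence _ (lebesgueType R) R leb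
    setT measurableT (fun n u => (tail_fun n%:R psi u)%:E) (cst 0%E)
    (fun u => (`|psi u|)%:E).
  - by move=> n; apply/measurable_EFinP; exact: measurable_tail_fun.
  - exact: measurable_cst.
  - apply: nearW => u _; apply: cvg_near_cst.
    near=> n; rewrite /tail_fun ifF//; apply/negbTE; rewrite -ltNge.
    near: n; exact: nbhs_infty_gtr.
  - exact: integrableR_norm.
  - apply: nearW => u n _; rewrite /tail_fun lee_fin.
    by case: ifP; rewrite ?normr_id ?normr0.
  rewrite integral_cst// mul0e => /fine_cvgP[_].
  by [].
have tge0 rho : 0 <= tail rho psi.
  by apply: Rintegral_ge0 => u _; exact: tail_fun_ge0.
apply/cvgrPdist_lt => e e0.
move/cvgrPdist_lt : tail0 => /(_ _ e0) [n _ /(_ n (leqnn n))].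
rewrite /= sub0r normrN ger0_norm// => tn.
near=> rho.
have nrho : n%:R <= rho by near: rho; exact: nbhs_pinfty_ge.
rewrite sub0r normrN ger0_norm//; apply: le_lt_trans tn.
exact: tail_nonincreasing.
Unshelve. all: by end_near. Qed.

(** Where f is not within e of c, either u is far from k / w and the tail of
    psi pays for it, or x is, and the factor K |wx - k|^r rho^-r, then at
    least K, does.  Having this factor for every k avoids splitting the series
    into near and far indices.  The condition near x is only required almost
    everywhere so that it is implied by an essential bound. *)
Lemma coefficient_dist psi f (w k c x e K gam r : R) :
    integrableR psi -> integralR psi = 1 ->
    measurable_fun [set: lebesgueType R] (f : lebesgueType R -> R) ->
    0 < w -> 0 < gam -> 0 <= e -> 0 <= K -> 0 < r ->
    (\forall u \ae (@leb R), `|f u - c| <= K) ->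
    (\forall u \ae (@leb R), `|u - x| < gam -> `|f u - c| <= e) ->
  let rho := gam / 2 * w in
  integrableR (fun u => psi (w * u - k) * f u) /\
  `|w * integralR (fun u => psi (w * u - k) * f u) - c| <=
    integralR (fun u => `|psi u|) * (e + K * (`|w * x - k| `^ r * rho `^ (- r)))
    + K * tail rho psi.
Proof.
move=> ipsi psi1 mf w0 gam0 e0 K0 r0 fK fe rho.
have rho0 : 0 < rho by rewrite mulr_gt0// divr_gt0.
set q := _ `^ r * _; have q0 : 0 <= q by rewrite mulr_ge0 ?powR_ge0.
set A := e + K * q; have A0 : 0 <= A by rewrite addr_ge0// mulr_ge0.
have ipsiw := integrableR_affine k w0 ipsi.
pose H t := `|psi t| * A + K * tail_fun rho psi t.
have inpsi := integrableR_norm ipsi.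
have iT := integrable_tail_fun rho ipsi.
have i1 : integrableR (fun t => `|psi t| * A) by exact: integrableZr inpsi.
have i2 : integrableR (fun t => K * tail_fun rho psi t).
  exact: integrableZl iT.
have iH : integrableR H by exact: integrableD i1 i2.
have H0 t : 0 <= H t.
  by rewrite addr_ge0// mulr_ge0// tail_fun_ge0.
pose g u := psi (w * u - k) * (f u - c).
have mg : measurable_fun [set: lebesgueType R] (g : lebesgueType R -> R).
  apply: measurable_funM; first exact: integrableR_measurable ipsiw.
  exact: measurable_funB.
have gH : \forall u \ae (@leb R), `|g u| <= H (w * u - k).
  apply: filterS2 fK fe => u fuK feu; rewrite /g normrM /H.
  (* Three cases: u near x, wu far from k, wx far from k. *)
  have [ux|ux] := ltP `|u - x| gam.
    apply: (@le_trans _ _ (`|psi (w * u - k)| * A)); last first.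
      by rewrite lerDl mulr_ge0// tail_fun_ge0.
    by rewrite ler_wpM2l// (le_trans (feu ux))// lerDl mulr_ge0.
  have [uk|uk] := leP rho `|w * u - k|.
    rewrite /tail_fun uk mulrC -[leLHS]add0r lerD//; last by rewrite ler_wpM2r.
    by rewrite mulr_ge0.
  apply: (@le_trans _ _ (`|psi (w * u - k)| * A)); last first.
    by rewrite lerDl mulr_ge0// tail_fun_ge0.
  rewrite ler_wpM2l// (le_trans fuK)// /A -[leLHS]add0r lerD//.
  rewrite ler_peMr//.
  have xk : rho <= `|w * x - k|.
    have : w * gam <= `|w * u - w * x|.
      by rewrite -mulrBr normrM gtr0_norm// ler_pM2l.
    have : `|w * u - w * x| <= `|w * u - k| + `|w * x - k|.
      by rewrite (_ : _ - _ = (w * u - k) - (w * x - k)) ?ler_normB//; ring.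
    have : rho + rho = w * gam by rewrite /rho; field.
    lra.
  rewrite /q powRN ler_pdivlMr ?powR_gt0// mul1r.
  by apply: ge0_ler_powR; rewrite ?nnegrE ?(ltW r0) ?(ltW rho0).
have [ig gle] := integrableR_dominated mg (integrableR_affine k w0 iH)
  (fun u => H0 _) gH.
have ic : integrableR (fun u => psi (w * u - k) * c).
  exact: integrableZr ipsiw.
have fE : (fun u => psi (w * u - k) * f u) =
          (fun u => g u + psi (w * u - k) * c).
  by apply/funext => u; rewrite /g; ring.
(* The constant c passes through because w * \int psi(wu - k) du = 1. *)
rewrite fE; split; first exact: integrableD ig ic.
rewrite /integralR RintegralD// -/(integralR _).
rewrite RintegralZr//.
rewrite -![Rintegral _ _ _]/(integralR _) integralR_affine// psi1.
rewrite mulrDr mulr1 mulrA divff ?gt_eqF// mul1r addrK normrM gtr0_norm//.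
rewrite -ler_pdivlMl//; apply: le_trans gle _.
rewrite integralR_affine// ler_pM2l ?invr_gt0//.
by rewrite /integralR RintegralD// RintegralZr// RintegralZl.
Qed.

End coef.

(** * Moments of the kernel *)

Section kernels.
Context {R : realType}.
Implicit Types (phi psi f : R -> R).

Lemma Lp_oo_ae_bounded f : Lp +oo%E f ->
  measurable_fun [set: lebesgueType R] (f : lebesgueType R -> R) /\
  exists2 M : R, 0 <= M & \forall u \ae (@leb R), `|f u| <= M.
Proof.
rewrite /Lp inE => /andP[]; rewrite !inE /= => mf fin; split => //.
move: fin; rewrite /finite_norm unlock /Lnorm.
(* The norm is 0 by convention when the measure is 0; everything then holds
   almost everywhere. *)
case: ifPn => [_|].
  move=> /ess_supr_bounded[M fM]; exists `|M| => //.
  by apply: filterS fM => u /le_trans; apply; exact: ler_norm.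
rewrite -leNgt measure_le0 => /eqP T0 _; exists 0 => //.
by exists setT.
Qed.

(** Two integers are at distance at least 1, so at most one of them is within
    1/2 of u. *)
Lemma abs_zsum_le_near (B d u : R) : 0 <= B -> d <= 1 / 2 ->
  abs_zsum_le (fun k : int => if `|u - k%:~R| < d then B else 0) B.
Proof.
move=> B0 d2; apply: esum_abs_zsum_le.
pose I := [set k : int | `|u - k%:~R| < d].
rewrite (_ : (\esum_(k in _) _)%E = (\esum_(k in I) B%:E)%E); last first.
  rewrite [RHS]esum_mkcond; apply: eq_esum => k _.
  have -> : (k \in I) = (`|u - k%:~R| < d) by apply/idP/idP; rewrite inE.
  by case: ifP => _; rewrite ?normr0 ?ger0_norm.
have [[k0 Ik0]|I0] := pselect (exists k, I k); last first.
  have -> : I = set0 by apply/seteqP; split=> // k Ik; apply: I0; exists k.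
  by rewrite esum_set0 lee_fin.
have -> : I = [set k0]; last by rewrite esum_set1 ?lee_fin.
apply/seteqP; split=> [k Ik|_ ->//] /=.
apply/eqP; rewrite eq_le -!ltzD1 -!(ltr_int R) !intrD/=.
move: Ik Ik0; rewrite /I /= !ltr_norml => /andP[? ?] /andP[? ?].
by apply/andP; split; lra.
Qed.

(** The moment of order 0 is controlled by that of order r: for |t| >= d one
    has |phi t| <= d^-r |phi t| |t|^r, and for |t| < d, where phi is bounded by
    B, only one term of the series occurs. *)
Lemma kernel_abs_zsum phi psi : kernel_pair phi psi ->
  exists r M0 Mr : R, [/\ 0 < r, 0 <= M0,
    forall u : R, abs_zsum_le (fun k => phi (u - k%:~R)) M0 &
    forall u : R, abs_zsum_le
      (fun k => `|phi (u - k%:~R)| * `|u - k%:~R| `^ r) Mr].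
Proof.
move=> [_ _ phib _ _ _ [r r0 Mroo]].
pose Mr := fine (abs_moment r phi).
have Mr_ge0 : (0 <= abs_moment r phi)%E.
  apply: (@le_trans _ _ (\esum_(k in [set: int])
    (`|phi (0 - k%:~R)| * `|0 - k%:~R| `^ r)%:E)%E).
    by apply: esum_ge0 => k _; rewrite lee_fin mulr_ge0// powR_ge0.
  by apply: ereal_sup_ubound; exists 0.
have moment u : abs_zsum_le
    (fun k => `|phi (u - k%:~R)| * `|u - k%:~R| `^ r) Mr.
  apply: esum_abs_zsum_le; rewrite fineK ?ge0_fin_numE//.
  apply: ereal_sup_ubound; exists u => //.
  by apply: eq_esum => k _; rewrite [in RHS]ger0_norm ?mulr_ge0// powR_ge0.
have [B [B0 [d [d0 d2 phiB]]]] : exists B, 0 <= B /\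
    exists d, [/\ 0 < d, d <= 1 / 2 & forall t, `|t| < d -> `|phi t| <= B].
  near (pinfty_nbhs R) => B; exists B; split.
    by near: B; exact: nbhs_pinfty_ge.
  have : nbhs (0 : R) [set x | `|phi x| <= B] by near: B; exact: phib.
  move=> /nbhs_ballP[d /= d0 db]; exists (Num.min d (1 / 2)); split.
  - by rewrite lt_min d0/=; lra.
  - by rewrite ge_min lexx orbT.
  - move=> t; rewrite lt_min => /andP[td _]; apply: db.
    by rewrite /ball /= sub0r normrN.
exists r, (B * 1 + Mr * d `^ (- r)), Mr; split => //.
- by rewrite addr_ge0 ?mulr_ge0 ?powR_ge0 ?fine_ge0.
move=> u; apply: (abs_zsum_le_dominated ler01 (powR_ge0 _ _) _
  (abs_zsum_le_near u B0 d2) (moment u)) => k.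
set t := u - _.
have [td|td] := ltP `|t| d.
  rewrite mulr1 (ger0_norm B0) (le_trans (phiB _ td))// lerDl.
  by rewrite mulr_ge0 ?powR_ge0.
rewrite normr0 mul0r add0r normrM normr_id (ger0_norm (powR_ge0 _ _)) -mulrA.
rewrite ler_peMr// powRN ler_pdivlMr ?powR_gt0// mul1r.
by apply: ge0_ler_powR; rewrite ?nnegrE ?(ltW r0) ?(ltW d0).
Unshelve. all: by end_near. Qed.

End kernels.

(** * Convergence of the operators *)

Lemma powR_opp_cvg0 (R : realType) (r : R) : 0 < r ->
  x `^ (- r) @[x --> +oo] --> (0 : R).
Proof.
move=> r0; apply/cvgrPdist_lt => e e0; near=> x.
have b0 : 0 < e^-1 `^ r^-1 by rewrite powR_gt0// invr_gt0.
have bx : e^-1 `^ r^-1 < x by near: x; exact: nbhs_pinfty_gt.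
have x0 := lt_trans b0 bx.
rewrite sub0r normrN ger0_norm ?powR_ge0// powRN invf_plt ?posrE ?powR_gt0//.
have -> : e^-1 = (e^-1 `^ r^-1) `^ r.
  by rewrite -powRrM mulVf ?gt_eqF// powRr1// invr_ge0 ltW.
by rewrite gt0_ltr_powR// nnegrE ltW.
Unshelve. all: by end_near. Qed.

Section approximation.
Context {R : realType}.
Context (phi psi f : R -> R) (r M0 Mr : R) (r0 : 0 < r) (M0_ge0 : 0 <= M0)
  (phiM0 : forall u : R, abs_zsum_le (fun k => phi (u - k%:~R)) M0)
  (phiMr : forall u : R, abs_zsum_le
    (fun k => `|phi (u - k%:~R)| * `|u - k%:~R| `^ r) Mr)
  (phi1 : forall u : R, zsum (fun k => phi (u - k%:~R)) = 1)
  (ipsi : integrableR psi) (psi1 : integralR psi = 1)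
  (mf : measurable_fun [set: lebesgueType R] (f : lebesgueType R -> R)).

Let P := integralR (fun u => `|psi u|).

Let P_ge0 : 0 <= P. Proof. exact: Rintegral_ge0. Qed.

Lemma durrmeyer_term_abs_zsum (w x c e K gam : R) :
    0 < w -> 0 < gam -> 0 <= e -> 0 <= K ->
    (\forall u \ae (@leb R), `|f u - c| <= K) ->
    (\forall u \ae (@leb R), `|u - x| < gam -> `|f u - c| <= e) ->
  let rho := gam / 2 * w in
  abs_zsum_le
    (fun k => durrmeyer_term phi psi w f x k - phi (w * x - k%:~R) * c)
    (M0 * (P * e + K * tail rho psi) + Mr * (P * K * rho `^ (- r))).
Proof.
move=> w0 gam0 e0 K0 fK fe rho.
have t0 : 0 <= tail rho psi.
  by apply: Rintegral_ge0 => t _; exact: tail_fun_ge0.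
apply: (abs_zsum_le_dominated _ _ _ (phiM0 (w * x)) (phiMr (w * x))).
- by rewrite addr_ge0// mulr_ge0.
- by rewrite !mulr_ge0// powR_ge0.
move=> k; rewrite /durrmeyer_term -mulrBr normrM.
have [_ /= coef] := coefficient_dist k%:~R ipsi psi1 mf w0 gam0 e0 K0 r0 fK fe.
apply: le_trans (ler_wpM2l (normr_ge0 _) coef) _.
rewrite -/P -/rho (ger0_norm (_ : 0 <= `|phi _| * _)) ?mulr_ge0 ?powR_ge0//.
by rewrite le_eqVlt; apply/orP; left; apply/eqP; ring.
Qed.

(** Case c = 0 of the estimate, an essential bound M serving both as global
    and as local bound. *)
Lemma durrmeyer_term_cvg (w x M : R) : 0 < w -> 0 <= M ->
    (\forall u \ae (@leb R), `|f u| <= M) ->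
  cvg_zseries (durrmeyer_term phi psi w f x).
Proof.
move=> w0 M0' fM.
have fM0 : \forall u \ae (@leb R), `|f u - 0| <= M.
  by apply: filterS fM => u; rewrite subr0.
have fM1 : \forall u \ae (@leb R), `|u - x| < 1 -> `|f u - 0| <= M.
  by apply: filterS fM0.
have := durrmeyer_term_abs_zsum w0 ltr01 M0' M0' fM0 fM1.
move=> /= /abs_zsum_le_cvg; congr cvg_zseries.
by apply/funext => k; rewrite mulr0 subr0.
Qed.

(** The tolerance e is chosen before gam and K, and the threshold on w before
    x and c: this order of quantifiers yields both the pointwise and the
    uniform statement. *)
Lemma durrmeyer_cvg_unif (M eta : R) : 0 <= M ->
    (\forall u \ae (@leb R), `|f u| <= M) -> 0 < eta ->
  exists2 e : R, 0 < e & forall gam K : R, 0 < gam -> 0 <= K ->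
    \forall w \near +oo, forall x c,
      (\forall u \ae (@leb R), `|f u - c| <= K) ->
      (forall u, `|u - x| < gam -> `|f u - c| <= e) ->
      `|durrmeyer phi psi w f x - c| <= eta.
Proof.
move=> M0' fM eta0.
have D0 : 0 < M0 * P + 1 by rewrite ltr_wpDl// mulr_ge0.
(* This e makes M0 * P * e at most eta / 2; adding 1 avoids a zero divisor. *)
exists (eta / 2 / (M0 * P + 1)); first by rewrite !divr_gt0.
set e := eta / 2 / _ => gam K gam0 K0.
have e0 : 0 < e by rewrite !divr_gt0.
have rhoy : gam / 2 * w @[w --> +oo] --> +oo.
  by apply: gt0_cvgMry; [rewrite divr_gt0|exact: cvg_id].
have small : M0 * (K * tail (gam / 2 * w) psi) +
    Mr * (P * K * (gam / 2 * w) `^ (- r)) @[w --> +oo] --> 0.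
  rewrite -[X in _ --> X](_ : M0 * (K * 0) + Mr * (P * K * 0) = 0); last first.
    by ring.
  apply: cvgD; apply: cvgMr; apply: cvgMr.
    exact: (cvg_comp _ _ rhoy (tail_cvg0 ipsi)).
  exact: (cvg_comp _ _ rhoy (powR_opp_cvg0 r0)).
have eta2 : 0 < eta / 2 by rewrite divr_gt0.
move/cvgrPdist_lt : small => /(_ _ eta2) small.
near=> w => x c fK fe.
have w0 : 0 < w by near: w; exact: nbhs_pinfty_gt.
have : `|0 - (M0 * (K * tail (gam / 2 * w) psi) +
    Mr * (P * K * (gam / 2 * w) `^ (- r)))| < eta / 2 by near: w.
rewrite sub0r normrN => /(le_lt_trans (ler_norm _)) sw.
have fe' : \forall u \ae (@leb R), `|u - x| < gam -> `|f u - c| <= e.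
  exact: nearW.
have := durrmeyer_term_abs_zsum w0 gam0 (ltW e0) K0 fK fe'.
move=> /= /abs_zsum_le_norm.
rewrite -zsumBr ?phi1 ?mul1r//; last 2 first.
- exact: durrmeyer_term_cvg fM.
- exact: abs_zsum_le_cvg (phiM0 _).
move=> /le_trans; apply.
have Pe : M0 * (P * e) <= eta / 2.
  rewrite /e mulrA mulrCA ger_pMr// mulrC ler_pdivrMl// mulr1.
  by rewrite lerDl.
by rewrite mulrDr; lra.
Unshelve. all: by end_near. Qed.

End approximation.

Theorem theorem4p1 (R : realType) (phi psi : R -> R)
    (Hker : kernel_pair phi psi) (f : R -> R) (Hf : Lp +oo%E f) :
  (forall w : R, 0 < w -> durrmeyer_defined phi psi w f) /\
  (forall x : R, {for x, continuous f} ->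
     durrmeyer phi psi w f x @[w --> +oo] --> f x) /\
  (unif_cont_bounded f ->
     supnorm (durrmeyer phi psi w f \- f) @[w --> +oo] --> 0%E).
Proof.
have [mf [M M_ge0 fM]] := Lp_oo_ae_bounded Hf.
have [r [M0 [Mr [r0 M0_ge0 phiM0 phiMr]]]] := kernel_abs_zsum Hker.
have [_ psiL1 _ _ phi1 psi1 _] := Hker.
have ipsi : integrableR psi by exact/Lfun1_integrable.
have unif := durrmeyer_cvg_unif r0 M0_ge0 phiM0 phiMr phi1 ipsi psi1 mf M_ge0
  fM.
split; [|split].
- move=> w w0; split=> [k|x]; last first.
    exact: (durrmeyer_term_cvg r0 phiM0 phiMr ipsi psi1 mf x w0 M_ge0 fM).
  have fM0 : \forall u \ae (@leb R), `|f u - 0| <= M.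
    by apply: filterS fM => u; rewrite subr0.
  have fM1 : \forall u \ae (@leb R), `|u - 0| < 1 -> `|f u - 0| <= M.
    by apply: filterS fM0.
  by have [] := coefficient_dist k%:~R ipsi psi1 mf w0 ltr01 M_ge0 M_ge0 r0
    fM0 fM1.
- move=> x /= fx; apply/cvgrPdist_le => eta eta0.
  have [e e0 he] := unif _ eta0.
  move/cvgrPdist_le : fx => /(_ _ e0) /nbhs_ballP[gam /= gam0 fgam].
  have fK : \forall u \ae (@leb R), `|f u - f x| <= M + `|f x|.
    apply: filterS fM => u fu.
    by apply: le_trans (ler_normB _ _) _; rewrite lerD2r.
  have := he _ _ gam0 (addr_ge0 M_ge0 (normr_ge0 (f x))).
  apply: filterS => w /(_ x (f x) fK) h.
  rewrite distrC; apply: h => u ux; rewrite distrC; apply: fgam.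
  by rewrite /ball/= distrC.
- move=> [fuc [B [_ fB]]].
  pose B1 := `|B| + 1.
  have B10 : 0 <= B1 by rewrite addr_ge0.
  have fB1 x : `|f x| <= B1.
    by apply: fB => //; rewrite /B1; have := ler_norm B; lra.
  have bound (eta : R) : 0 < eta -> \forall w \near +oo,
      forall x, `|durrmeyer phi psi w f x - f x| <= eta.
    move=> eta0; have [e e0 he] := unif _ eta0.
    have [gam gam0 fgam] : exists2 gam, 0 < gam &
        forall x u, `|u - x| < gam -> `|f u - f x| <= e.
      have : entourage ((fun xy => (f xy.1, f xy.2)) @^-1`
          [set xy | ball xy.1 e xy.2]).
        by apply: fuc; exact: (entourage_ball _ (PosNum e0)).
      rewrite -entourage_ballE => -[gam /= gam0 fgam].
      exists gam => // x u ux; rewrite ltW// distrC.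
      by apply: (fgam (x, u)); rewrite /ball/= distrC.
    have := he _ _ gam0 (addr_ge0 B10 B10).
    apply: filterS => w h x; apply: h => [|u ux]; last exact: fgam.
    by apply: nearW => u; apply: le_trans (ler_normB _ _) _; exact: lerD.
  have sup0 w : (0 <= supnorm (durrmeyer phi psi w f \- f)%R)%E.
    apply: (@le_trans _ _ (`|(durrmeyer phi psi w f \- f)%R 0%R|)%:E).
      by rewrite lee_fin.
    by apply: ereal_sup_ubound; exists 0.
  have supb (eta : R) : 0 < eta -> \forall w \near +oo,
      (supnorm (durrmeyer phi psi w f \- f)%R <= eta%:E)%E.
    move=> /bound; apply: filterS => w h.
    by apply: ge_ereal_sup => _ [x _ <-]; rewrite lee_fin; exact: h.
  apply/fine_cvgP; split.
    apply: filterS (supb 1 ltr01) => w h.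
    by rewrite ge0_fin_numE// (le_lt_trans h)// ltry.
  apply/cvgrPdist_le => eta eta0; apply: filterS (supb _ eta0) => w h.
  rewrite sub0r normrN ger0_norm ?fine_ge0//.
  by rewrite -lee_fin fineK// ge0_fin_numE// (le_lt_trans h)// ltry.
Qed.
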